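(* Let $c>0$, let $a\in\mathbb{R}$, and let $\phi:\mathbb{R}\to\mathbb{R}$ be a continuous solitary wave with decay (i.e. $\phi(x)\to0$ as $|x|\to\infty$) satisfying $$\frac{\phi(x)}{3}\,(2c-\phi(x)) = (K*\phi^2)(x)+a,\qquad x\in\mathbb{R},\qquad K(x)=\tfrac12e^{-|x|}.$$ Then $a=0$.
   Context: The equation is the steady (traveling wave) form of the Degasperis-Procesi equation in nonlocal formulation, with wave speed $c$ and integration constant $a$; $(K*f)(x)=\int_{\mathbb{R}}K(x-y)f(y)\,\mathrm{d}y$ is the action of $L=(1-\partial_x^2)^{-1}$. *)

(* Defs.v *)
From HB Require Import structures.
From mathcomp Require Import all_boot all_order all_algebra.
From mathcomp Require Import all_classical all_reals all_analysis.
Import Order.TTheory GRing.Theory Num.Theory.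
Import numFieldNormedType.Exports.

Set Implicit Arguments.
Unset Strict Implicit.
Unset Printing Implicit Defensive.

Local Open Scope classical_set_scope.
Local Open Scope ring_scope.

(* The convolution kernel of (1 - d^2/dx^2)^-1 on the real line. *)
Definition dpK {R : realType} (x : R) : R := 2^-1 * expR (- `|x|).

(* Rintegral returns a conventional value when the integral is infinite or
   undefined. This never matters for dpK and a bounded measurable g, since
   then y |-> dpK (x - y) * g y is integrable for every x. *)
Definition convolution {R : realType} (f g : R -> R) (x : R) : R :=
  \int[lebesgue_measure]_y (f (x - y) * g y).

(* phi x --> 0 as `|x| --> +oo. *)
Definition decays {R : realType} (phi : R -> R) : Prop :=
  phi x @[x --> +oo] --> (0 : R) /\ phi x @[x --> -oo] --> (0 : R).

Definition steady_DP {R : realType} (c a : R) (phi : R -> R) : Prop :=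
  forall x : R,
    phi x / 3 * (2 * c - phi x) =
    convolution dpK (fun y => phi y ^+ 2) x + a.

(* Main.v *)
(* Substituting y + x for y, (K * phi^2)(x) is the integral of
   K(y) phi(y + x)^2, which is dominated by (sup phi^2) K(y) and tends to 0
   pointwise as x --> +oo. By dominated convergence K * phi^2 vanishes along the
   integers, as does phi (2c - phi) / 3, so passing to the limit in the equation
   leaves 0 = a. *)
Require Import Defs.
From mathcomp Require Import all_boot all_order all_algebra.
From mathcomp Require Import all_classical all_reals all_analysis.
From mathcomp Require Import measurable_realfun.
Import Order.TTheory GRing.Theory Num.Theory.
Import numFieldNormedType.Exports.

Local Open Scope classical_set_scope.
Local Open Scope ring_scope.

Lemma dpK_ge0 {R : realType} (x : R) : 0 <= dpK x.
Proof. by rewrite mulr_ge0 ?invr_ge0 ?expR_ge0. Qed.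

Lemma dpKN {R : realType} (x : R) : dpK (- x) = dpK x.
Proof. by rewrite /dpK normrN. Qed.

Lemma continuous_dpK {R : realType} : continuous (@dpK R).
Proof.
move=> x; apply: cvgMr; apply: continuous_comp; last exact: continuous_expR.
by apply: cvgN; exact: cvg_norm.
Qed.

(** The kernel is even, so its integral is twice the one over the half-line $x \ge 0$. There it lies
    below the density of the exponential law of rate 1, whose total mass is 1. *)
Lemma integrable_dpK {R : realType} :
  lebesgue_measure.-integrable [set: R] (EFin \o dpK).
Proof.
have mK := continuous_measurable_fun (@continuous_dpK R).
apply/integrableP; split; first exact/measurable_EFinP.
under eq_integral do rewrite /= ger0_norm ?dpK_ge0//.
rewrite ge0_symfun_integralT; first last.
- by move=> x /=; rewrite dpKN.
- exact: continuous_dpK.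
- exact: dpK_ge0.
rewrite lte_mul_pinfty//.
have mD : measurable [set x : R | 0 <= x] by rewrite -set_itvcy.
have mE : measurable_fun [set: R] (EFin \o exponential_pdf (1 : R)).
  by apply/measurable_EFinP; exact: measurable_exponential_pdf.
(* The density is nonnegative, so enlarging the domain from the half-line to the whole line only
   increases its integral. *)
apply: (@le_lt_trans _ _ (\int[lebesgue_measure]_x (exponential_pdf 1 x)%:E)%E).
  have pdf0 x : [set: R] x -> (0 <= (EFin \o exponential_pdf (1 : R)) x)%E.
    by move=> _; rewrite lee_fin exponential_pdf_ge0.
  have := ge0_subset_integral lebesgue_measure mD measurableT mE pdf0
    (@subsetT _ _).
  apply: le_trans.
  apply: ge0_le_integral => //.
  - by move=> x _; rewrite lee_fin dpK_ge0.
  - exact/measurable_EFinP/measurable_funTS.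
  - exact: measurable_funTS.
  - move=> x /= x0; rewrite lee_fin exponential_pdfE// mul1r mulN1r.
    by rewrite /dpK ger0_norm// ler_piMl ?expR_ge0// invf_le1 ?ler1n.
by rewrite integral_exponential_pdf ?ltry.
Qed.

(** Moving the shift from the kernel to [g] leaves the fixed weight [dpK y], which makes a bound
    uniform in [x] possible. The sign of [g] gives access to the substitution rule for nonnegative
    continuous integrands. *)
Lemma convolution_dpK_translate {R : realType} (g : R -> R) (x : R) :
    continuous g -> (forall y, 0 <= g y) ->
  convolution dpK g x = \int[lebesgue_measure]_y (dpK y * g (y + x)).
Proof.
move=> cg g0; rewrite /convolution /Rintegral; congr fine.
(* The change of variable is the translation by [x], with derivative 1; the value is read as [1 + 0]
   to match the sum rule. *)
have dF (y : R) : is_derive y 1 (+%R^~ x) (1 : R).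
  by rewrite -[X in is_derive _ _ _ X]addr0; exact: is_deriveD.
have F'E : ((+%R^~ x : R -> R)^`())%classic = cst 1.
  by apply/funext => y; rewrite derive1E derive_val.
rewrite (@increasing_ge0_integration_by_substitutionT R (+%R^~ x)); first last.
- by move=> y; rewrite mulr_ge0 ?dpK_ge0.
- move=> y; apply: cvgM; last exact: cg.
  apply: (cvg_comp (fun z => x - z) dpK); last exact: continuous_dpK.
  by apply: cvgB => //; exact: cvg_cst.
- exact: cvg_addrr.
- exact: cvg_addrr_Ny.
- by move=> y; apply: ex_derive.
- by rewrite F'E; exact: is_cvg_cst.
- by rewrite F'E; exact: is_cvg_cst.
- by rewrite F'E => ?; exact: cst_continuous.
- by move=> y z yz; rewrite ltrD2r.
apply: eq_integral => y _; rewrite F'E/= /GRing.mul/= mulr1.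
(* The kernel is now evaluated at $x - (y + x) = -y$, and evenness removes the sign. *)
by rewrite opprD addrCA subrr addr0 dpKN.
Qed.

Lemma convolution_dpK_cvg0 {R : realType} (g : R -> R) (M : R) :
    continuous g -> (forall y, 0 <= g y <= M) ->
    g y @[y --> +oo] --> 0 ->
  convolution dpK g n%:R @[n --> \oo] --> 0.
Proof.
move=> cg gM gy.
have g0 y : 0 <= g y by case/andP: (gM y).
under eq_cvg do rewrite convolution_dpK_translate//.
apply: fine_cvg.
(* The limit is written as the integral of the pointwise limit, the form dominated convergence
   concludes with. *)
have <- : (\int[lebesgue_measure]_(x in [set: R]) 0%:E = 0%:E)%E := integral0 _ _.
apply: (@dominated_cvg _ _ _ lebesgue_measure _ measurableT _ _
  (fun y => (M * dpK y)%:E)) => //.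
- move=> n; apply/measurable_EFinP; apply: continuous_measurable_fun => y.
  apply: cvgM; first exact: continuous_dpK.
  apply: (cvg_comp (fun z => z + n%:R) g); last exact: cg.
  by apply: cvgD => //; exact: cvg_cst.
- move=> y _; apply: cvg_EFin; first exact: nearW.
  rewrite -(mulr0 (dpK y)); apply: cvgMr.
  apply: (cvg_comp _ _ _ gy).
  exact: cvg_comp (@cvgr_idn R) (cvg_addrl y).
- exact: (integrableZl _ M integrable_dpK).
- move=> n y _; rewrite lee_fin ger0_norm ?mulr_ge0 ?dpK_ge0//.
  by rewrite mulrC ler_wpM2r ?dpK_ge0//; case/andP: (gM (y + n%:R)).
Qed.

(** Decay bounds [phi] by 1 to the right of some [A] and to the left of some [B]; the extreme value
    theorem handles the segment between. *)
Lemma decays_bounded {R : realType} (phi : R -> R) :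
  continuous phi -> decays phi -> exists M, forall x, `|phi x| <= M.
Proof.
move=> cphi [/cvgr0Pnorm_le/(_ _ ltr01)[A [_ phiA]]].
move=> /cvgr0Pnorm_le/(_ _ ltr01)[B [_ phiB]].
have [z zP] : exists z, forall x, x \in `[B, A] -> `|phi x| <= z.
  (* If $A < B$ the segment is empty and any bound will do. *)
  have [BA|AB] := leP B A; last first.
    exists 0 => x; rewrite in_itv/= => /andP[/le_trans/[apply]].
    by rewrite leNgt AB.
  have [|c _ cP] := @EVT_max R (fun x => `|phi x|) _ _ BA.
    by apply: continuous_subspaceT => x; apply: cvg_norm; exact: cphi.
  by exists `|phi c|.
exists (Num.max 1 z) => x; rewrite le_max.
have [xB|Bx] := ltP x B; first by rewrite phiB.
have [Ax|xA] := ltP A x; first by rewrite phiA.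
by rewrite zP ?orbT// in_itv/= Bx.
Qed.

Theorem corollary2p3 (R : realType) (c a : R) (phi : R -> R)
    (hc : 0 < c) (phi_cont : continuous phi) (phi_decay : decays phi)
    (phi_sol : steady_DP c a phi) :
  a = 0.
Proof.
have [M phiM] := @decays_bounded R phi phi_cont phi_decay.
have phi_n : phi n%:R @[n --> \oo] --> 0.
  exact: cvg_comp (@cvgr_idn R) phi_decay.1.
have conv0 : convolution dpK (fun y => phi y ^+ 2) n%:R @[n --> \oo] --> 0.
  apply: (@convolution_dpK_cvg0 R _ (M ^+ 2)).
  - by move=> x; apply: cvgM; exact: phi_cont.
  - move=> x; rewrite sqr_ge0 -(@real_normK _ (phi x)) ?num_real//.
    by rewrite lerXn2r ?nnegrE ?(le_trans _ (phiM x)).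
  - by rewrite -(mulr0 0); apply: cvgM; exact: phi_decay.1.
(* By the equation this sequence is constantly [a], so its limit, computed here term by term, must
   equal [a]. *)
have : phi n%:R / 3 * (2 * c - phi n%:R) -
    convolution dpK (fun y => phi y ^+ 2) n%:R @[n --> \oo]
    --> 0 / 3 * (2 * c - 0) - 0.
  apply: cvgB => //; apply: cvgM; first exact: cvgMl.
  by apply: cvgB => //; exact: cvg_cst.
under eq_cvg do rewrite phi_sol addrC addKr.
by rewrite !mul0r subr0 => /(cvg_unique _ (cvg_cst a)) ->.
Qed.
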